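(* Let $p$ be a prime and $F\colon\mathbb F_p^n\to\mathbb F_p^n$ a plateaued function that is $d$-to-$1$ for some $d\mid p^n-1$ with $d>2$. Then $n$ is even, $d=p^t+1$ for some integer $t\ge1$ with $t\mid n/2$, and among the component functions $F_b$, $b\neq0$, exactly $p^n-1-\frac{p^n-1}{p^t+1}$ are bent and exactly $\frac{p^n-1}{p^t+1}$ are plateaued with amplitude $p^{n/2+t}$. In particular the linearity of $F$ is $\mathcal L(F)=p^{n/2+t}$.
   Context: Standard scalar product $\langle x,y\rangle=\sum_ix_iy_i$, $\zeta_p=e^{2\pi i/p}$. For $f\colon\mathbb F_p^n\to\mathbb F_p$, $W_f(a)=\sum_x\zeta_p^{f(x)-\langle a,x\rangle}$; $f$ is $t$-plateaued (amplitude $p^{(n+t)/2}$) if $|W_f(a)|\in\{0,p^{(n+t)/2}\}$ for all $a$; $f$ is bent if $|W_f(a)|=p^{n/2}$ for all $a$. Components: $F_b(x)=\langle b,F(x)\rangle$, $W_F(b,a)=W_{F_b}(a)$. $F$ is plateaued if each $F_b$, $b\neq0$, is $s_b$-plateaued for some $s_b$. $F$ is $d$-to-$1$ if $d\mid p^n-1$ and $F$ has exactly one preimage set of size $1$ and all other nonempty preimage sets have size exactly $d$. The linearity is $\mathcal L(F)=\max_{a\in\mathbb F_p^n,\,b\in\mathbb F_p^n\setminus\{0\}}|W_F(b,a)|$. *)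

(* Defs.v *)
From mathcomp Require Import all_boot all_order all_algebra.
From mathcomp Require Import all_classical reals topology normedtype exp trigo.
From mathcomp.real_closed Require Import complex.

Set Implicit Arguments.
Unset Strict Implicit.
Unset Printing Implicit Defensive.

Import Order.TTheory GRing.Theory Num.Theory.

Local Open Scope ring_scope.
Local Open Scope complex_scope.

(* F_p^n is 'rV['F_p]_n; 'F_p is the field of order p only for p prime. *)

Definition dot (p n : nat) (x y : 'rV['F_p]_n) : 'F_p :=
  \sum_(i < n) x ord0 i * y ord0 i.

Definition zeta (R : realType) (p : nat) : R[i] :=
  cos (2 * pi / p%:R) +i* sin (2 * pi / p%:R).

(* The exponent f x - <a, x> is computed in 'F_p and then read as its
   representative in {0, .., p - 1}, which is harmless as zeta ^+ p = 1. *)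
Definition walsh (R : realType) (p n : nat) (f : 'rV['F_p]_n -> 'F_p)
    (a : 'rV['F_p]_n) : R[i] :=
  \sum_(x : 'rV['F_p]_n) zeta R p ^+ nat_of_ord (f x - dot a x).

(* The modulus as a real number; `|_| on R[i] takes its values in R[i]. *)
Definition modulus (R : realType) (z : R[i]) : R := ComplexField.Normc.normc z.

Definition plateaued_amplitude (R : realType) (p n : nat) (A : R)
    (f : 'rV['F_p]_n -> 'F_p) : bool :=
  [forall a, (modulus (walsh R f a) == 0) || (modulus (walsh R f a) == A)].

Definition t_plateaued (R : realType) (p n t : nat)
    (f : 'rV['F_p]_n -> 'F_p) : bool :=
  plateaued_amplitude (p%:R `^ ((n + t)%:R / 2) : R) f.

Definition bent (R : realType) (p n : nat) (f : 'rV['F_p]_n -> 'F_p) : bool :=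
  [forall a, modulus (walsh R f a) == p%:R `^ (n%:R / 2)].

Definition component (p n : nat) (F : 'rV['F_p]_n -> 'rV['F_p]_n)
    (b : 'rV['F_p]_n) : 'rV['F_p]_n -> 'F_p :=
  fun x => dot b (F x).

Definition plateaued (R : realType) (p n : nat)
    (F : 'rV['F_p]_n -> 'rV['F_p]_n) : Prop :=
  forall b, b != 0 -> exists s : nat, t_plateaued R s (component F b).

Definition fiber (p n : nat) (F : 'rV['F_p]_n -> 'rV['F_p]_n)
    (y : 'rV['F_p]_n) : {set 'rV['F_p]_n} := [set x | F x == y].

Definition d_to_1 (p n d : nat) (F : 'rV['F_p]_n -> 'rV['F_p]_n) : Prop :=
  [/\ (d %| p ^ n - 1)%N,
      #|[set y | #|fiber F y| == 1%N]| = 1%N &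
      forall y, fiber F y != finset.set0 -> #|fiber F y| <> 1%N ->
        #|fiber F y| = d].

(* Moduli are nonnegative, so the default value 0 does not affect the maximum
   as soon as its range is nonempty, i.e. for n > 0. *)
Definition linearity (R : realType) (p n : nat)
    (F : 'rV['F_p]_n -> 'rV['F_p]_n) : R :=
  \big[Num.max/0]_(b : 'rV['F_p]_n | b != 0)
    \big[Num.max/0]_(a : 'rV['F_p]_n) modulus (walsh R (component F b) a).

(* Main.v *)
Require Import Defs.
From HB Require Import structures.
From mathcomp Require Import all_boot all_order all_algebra all_field.
From mathcomp Require Import ring zify.
From mathcomp Require Import all_classical reals topology normedtype exp trigo.
From mathcomp.real_closed Require Import complex.

(* Let y0 be the value attained once. Up to a p-th root of unity, W_F(b,0) is
   w_b = sum_x zeta^<b, F(x) - y0>, and w_b = 1 (mod d) in Z[zeta] because all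
   the other fibers have size d; so w_b is not 0 and |w_b|^2 is a power of p.
   Since 1 - zeta generates the only prime of Z[zeta] above p, for each Galois
   conjugate y of w_b the number y w_b^* / p^m is an algebraic integer with all
   conjugates on the unit circle; it is 1 (mod d), hence equal to 1 as d > 2.
   Therefore w_b is a rational integer k_b.
   Fourier inversion and Parseval give, over b <> 0, sum k_b = 0 and
   sum k_b^2 = p^n (d - 1)(p^n - 1). A value with k_b^2 = p^n must occur, say
   al, and r_b = k_b / al satisfies r_b = 1 (mod d), so that
   (r_b - 1)(r_b - 1 + d) >= 0; but these numbers sum to 0, so r_b is 1 or 1 - d, and d - 1 = p^t since k_b^2
   is a power of p. *)

Set Implicit Arguments.
Unset Strict Implicit.
Unset Printing Implicit Defensive.

Import Order.TTheory GRing.Theory Num.Theory.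
Local Open Scope ring_scope.

(** * The ring of integers of a cyclotomic field of prime conductor *)

(** Elements of Z[z] are handled through integer polynomials: evaluating the same [f] at another
    primitive root yields a Galois conjugate. *)
Definition evz (C : numClosedFieldType) (z : C) (f : {poly int}) : C :=
  (horner_eval z \o map_poly intr) f.

HB.instance Definition _ (C : numClosedFieldType) (z : C) :=
  GRing.RMorphism.copy (evz z)
    (horner_eval z \o map_poly (intr : int -> C)).

Section PrimeRoot.

Variables (C : numClosedFieldType) (p : nat).
Hypothesis p_pr : prime p.
Implicit Types (z : C) (f g h e : {poly int}).

Let p_gt1 := prime_gt1 p_pr.
Let p_gt0 := prime_gt0 p_pr.

Lemma evzX z : evz z 'X = z.
Proof. by rewrite /evz /= map_polyX /horner_eval hornerX. Qed.

Lemma evzC z (k : int) : evz z k%:P = k%:~R.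
Proof. by rewrite /evz /= map_polyC /horner_eval hornerC. Qed.

Lemma evz_comp z f k : evz z (f \Po 'X^k) = evz (z ^+ k) f.
Proof.
by rewrite /evz /= /horner_eval map_comp_poly horner_comp map_polyXn hornerXn.
Qed.

Lemma prim_root_neq1 z : p.-primitive_root z -> z != 1.
Proof.
move=> zP; apply/negP=> /eqP z1; have := prim_order_dvd zP 1.
by rewrite z1 expr1n eqxx dvdn1 => /eqP p1; move: p_gt1; rewrite p1.
Qed.

Lemma prim_root_prime (F : fieldType) (z : F) :
  z ^+ p = 1 -> z != 1 -> p.-primitive_root z.
Proof.
move=> zp z1; have [m mP] := prim_order_exists p_gt0 zp.
case/primeP: p_pr => _ H /H /orP[]/eqP mE; last by rewrite -mE.
move: mP; rewrite mE => /prim_expr_order; rewrite expr1 => /eqP.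
by rewrite (negPf z1).
Qed.

Lemma prim_rootX z j : p.-primitive_root z -> (0 < j < p)%N ->
  p.-primitive_root (z ^+ j).
Proof.
move=> zP /andP[j0 jp]; rewrite prim_root_exp_coprime // coprime_sym.
by rewrite prime_coprime // gtnNdvd.
Qed.

Lemma norm_prim_root z : p.-primitive_root z -> `|z| = 1.
Proof.
move=> zP; apply/eqP; rewrite -(pexpr_eq1 p_gt0) // -normrX.
by rewrite prim_expr_order // normr1.
Qed.

Lemma prim_root_conj z : p.-primitive_root z -> z^* = z ^+ p.-1.
Proof.
move=> zP; have z1 := norm_prim_root zP.
have z0 : z != 0 by rewrite -normr_gt0 z1.
apply: (mulfI z0); rewrite -normCK z1 expr1n -exprS prednK //.
by rewrite prim_expr_order.
Qed.

Definition prim_roots z := [seq z ^+ j | j <- iota 1 p.-1].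

Lemma prim_rootsP z x :
  reflect (exists2 j, (0 < j < p)%N & x = z ^+ j) (x \in prim_roots z).
Proof.
apply: (iffP mapP) => -[j jp ->]; exists j => //; move: jp;
  by rewrite mem_iota add1n prednK.
Qed.

Lemma uniq_prim_roots z : p.-primitive_root z -> uniq (prim_roots z).
Proof.
move=> zP; rewrite map_inj_in_uniq ?iota_uniq // => i j.
rewrite !mem_iota add1n prednK // => /andP[_ ip] /andP[_ jp] /eqP.
by rewrite (eq_prim_root_expr zP) !modn_small // => /eqP.
Qed.

Lemma mem_prim_roots z x : p.-primitive_root z ->
  (x \in prim_roots z) = p.-primitive_root x.
Proof.
move=> zP; apply/prim_rootsP/idP => [[j jp ->]|xP]; first exact: prim_rootX.
have [j xE] := prim_rootP zP (prim_expr_order xP).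
exists j => //; rewrite ltn_ord andbT lt0n.
by apply: contraTneq (prim_root_neq1 xP) => j0; rewrite xE j0 expr0 eqxx.
Qed.

Lemma perm_prim_roots z z' : p.-primitive_root z -> p.-primitive_root z' ->
  perm_eq (prim_roots z) (prim_roots z').
Proof.
move=> zP zP'; apply: uniq_perm; rewrite ?uniq_prim_roots // => x.
by rewrite !mem_prim_roots.
Qed.

(** The [p]-th cyclotomic polynomial, as [p] is prime. *)
Definition cyclop : {poly int} := \poly_(i < p) 1.

Lemma size_cyclop : size cyclop = p.
Proof. by rewrite size_poly_eq // oner_neq0. Qed.

Lemma cyclop_monic : cyclop \is monic.
Proof.
by apply/monicP; rewrite lead_coefE size_cyclop coef_poly ltn_predL p_gt0.
Qed.

Lemma mulX1_cyclop : ('X - 1) * cyclop = 'X^p - 1.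
Proof.
rewrite subrX1; congr (_ * _); rewrite /cyclop poly_def.
by apply: eq_bigr => i _; rewrite scale1r.
Qed.

Lemma cyclop1 : cyclop.[1] = p%:R.
Proof.
rewrite /cyclop poly_def horner_sum.
rewrite (eq_bigr (fun=> 1)) ?sumr_const ?card_ord // => i _.
by rewrite scale1r hornerXn expr1n.
Qed.

Lemma root_map_cyclop (F : fieldType) (x : F) : (p%:R != 0 :> F) ->
  root (map_poly intr cyclop) x -> (x ^+ p == 1) && (x != 1).
Proof.
move=> pF rx.
have := congr1 (fun f => (map_poly intr f : {poly F}).[x]) mulX1_cyclop.
rewrite rmorphM !rmorphB /= map_polyX map_polyXn rmorph1.
rewrite hornerM (eqP rx) mulr0 !hornerE => /esym/eqP; rewrite subr_eq0 => -> /=.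
apply: contraNneq pF => x1; move: rx; rewrite x1 /root.
have -> : (1 : F) = (1 : int)%:~R by [].
by rewrite horner_map cyclop1 /= rmorph_nat.
Qed.

Lemma evz_cyclop z : p.-primitive_root z -> evz z cyclop = 0.
Proof.
move=> zP; have /eqP := congr1 (evz z) mulX1_cyclop.
rewrite rmorphM !rmorphB /= rmorphXn /= evzX rmorph1 prim_expr_order // subrr.
by rewrite mulf_eq0 subr_eq0 (negPf (prim_root_neq1 zP)) => /eqP.
Qed.

(** Over the rationals [f] and [cyclop] have a nonconstant gcd, since both vanish at [z]. A root of
    it in [algC] is a primitive [p]-th root of unity, and its minimal polynomial, which divides [f],
    has size [p]. *)
Lemma evz_eq0_size z f : p.-primitive_root z -> f != 0 -> evz z f = 0 ->
  (p <= size f)%N.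
Proof.
move=> zP f0 fz; pose Q := (map_poly intr : {poly int} -> {poly rat}).
have QC (L : numFieldType) h :
    map_poly ratr (Q h) = map_poly intr h :> {poly L}.
  by rewrite -map_poly_comp; apply: eq_map_poly => k /=; rewrite ratr_int.
pose g := gcdp (Q f) (Q cyclop).
have fQ0 : Q f != 0 by rewrite map_poly_eq0_id0 // intr_eq0 lead_coef_eq0.
have g0 : g != 0 by rewrite gcdp_eq0 (negPf fQ0).
have rg : root (map_poly ratr g) z.
  rewrite gcdp_map root_gcd !QC.
  by apply/andP; split; apply/eqP => //; exact: evz_cyclop.
have : size (map_poly ratr g : {poly algC}) != 1%N.
  rewrite size_map_poly -(size_map_poly (ratr : {rmorphism rat -> C})).
  by rewrite neq_ltn (root_size_gt1 _ rg) ?orbT // map_poly_eq0.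
case/closed_rootP=> y; rewrite gcdp_map root_gcd !QC => /andP[ry1 ry2].
have pN0 : p%:R != 0 :> algC by rewrite pnatr_eq0 -lt0n.
have /andP[/eqP yp y1] := root_map_cyclop pN0 ry2.
have yP := prim_root_prime yp y1.
have [q [qE q_mon] qdiv] := minCpolyP y.
have sq : size q = p.
  rewrite -(size_map_poly (ratr : {rmorphism rat -> algC})) -qE.
  by rewrite (minCpoly_cyclotomic yP) size_cyclotomic totient_prime // prednK.
have : (q %| Q f) by rewrite -qdiv QC.
move=> /(dvdp_leq fQ0); rewrite sq size_map_inj_poly //; exact: intr_inj.
Qed.

Lemma evz_eq0 z f : p.-primitive_root z -> evz z f = 0 ->
  exists g, f = g * cyclop.
Proof.
move=> zP fz; exists (Pdiv.CommonRing.rdivp f cyclop).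
have fE := Pdiv.RingMonic.rdivp_eq cyclop_monic f.
have [r0|r0] := eqVneq (Pdiv.CommonRing.rmodp f cyclop) 0.
  by rewrite {1}fE r0 addr0.
have : evz z (Pdiv.CommonRing.rmodp f cyclop) = 0.
  by move: fz; rewrite {1}fE rmorphD rmorphM /= evz_cyclop // mulr0 add0r.
move=> /(evz_eq0_size zP r0); rewrite leqNgt -[X in (_ < X)%N]size_cyclop.
by rewrite Pdiv.CommonRing.ltn_rmodp monic_neq0 ?cyclop_monic.
Qed.

Lemma evz_reduce z f : p.-primitive_root z ->
  exists2 g : {poly int}, (size g < p)%N & evz z f = evz z g.
Proof.
move=> zP; exists (Pdiv.CommonRing.rmodp f cyclop).
  rewrite -[X in (_ < X)%N]size_cyclop.
  by rewrite Pdiv.CommonRing.ltn_rmodp monic_neq0 ?cyclop_monic.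
rewrite {1}(Pdiv.RingMonic.rdivp_eq cyclop_monic f) rmorphD rmorphM /=.
by rewrite evz_cyclop // mulr0 add0r.
Qed.

(** Stands in for the Galois action: a polynomial vanishing at one primitive root is a multiple of
    [cyclop], so it vanishes at all of them. *)
Lemma evz_eq0_prim z z' f : p.-primitive_root z -> p.-primitive_root z' ->
  evz z f = 0 -> evz z' f = 0.
Proof.
move=> zP zP' /(evz_eq0 zP)[g ->].
by rewrite rmorphM /= evz_cyclop // mulr0.
Qed.

Lemma evz_eq_prim z z' f g : p.-primitive_root z -> p.-primitive_root z' ->
  evz z f = evz z g -> evz z' f = evz z' g.
Proof.
move=> zP zP' fg; apply/eqP; rewrite -subr_eq0 -rmorphB /=.
by apply/eqP/(evz_eq0_prim zP) => //; rewrite rmorphB /= fg subrr.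
Qed.

(** Shows that f(1) mod p depends only on f(z): this is the residue map at the prime [1 - z]. *)
Lemma evz_eq0_horner1 z f : p.-primitive_root z -> evz z f = 0 ->
  (p %| f.[1])%Z.
Proof.
move=> zP /(evz_eq0 zP)[g ->]; rewrite hornerM cyclop1 pmulrn.
by rewrite dvdz_mull // intz.
Qed.

(** The powers [z ^+ i] with [i < p - 1] are independent over the integers, so constant coefficients
    may be compared. *)
Lemma evz_int_dvd z (k : int) (d : nat) f : p.-primitive_root z ->
  k%:~R = d%:R * evz z f -> (d %| k)%Z.
Proof.
move=> zP; have [g sg ->] := evz_reduce f zP => kE.
pose h := k%:P - d%:R * g.
have hz : evz z h = 0.
  by rewrite /h rmorphB rmorphM /= evzC rmorph_nat kE subrr.
have sh : (size h < p)%N.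
  rewrite (leq_ltn_trans (size_polyD _ _)) // gtn_max size_polyN.
  rewrite (leq_ltn_trans (size_polyC_leq1 _)) //=.
  by rewrite -polyC_natr mul_polyC (leq_ltn_trans (size_scale_leq _ _)).
have h0 : h = 0.
  by apply/eqP; apply: contraLR sh => hN0; rewrite -leqNgt (evz_eq0_size zP).
have /eqP := congr1 (fun u : {poly int} => u`_0) h0.
rewrite coefB coefC eqxx -polyC_natr mul_polyC coefZ coef0 subr_eq0 => /eqP ->.
by rewrite dvdz_mulr // natz.
Qed.

(** A representative of size below [p], minus its value at [z], vanishes at all [p - 1] conjugates
    of [z], hence is zero. *)
Lemma evz_int_fixed z f : p.-primitive_root z ->
  (forall j, (0 < j < p)%N -> evz (z ^+ j) f = evz z f) ->
  exists k : int, evz z f = k%:~R.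
Proof.
move=> zP; have [g sg fg] := evz_reduce f zP => fix_f; exists g`_0.
pose h := map_poly intr g - (evz z g)%:P.
suff h0 : h = 0.
  have /eqP := congr1 (fun u : {poly C} => u`_0) h0.
  by rewrite coefB coefC eqxx coef_map /= coef0 subr_eq0 fg => /eqP.
have urs := uniq_prim_roots zP; set rs := prim_roots z in urs.
have rrs : all (root h) rs.
  apply/allP=> _ /prim_rootsP[j jp ->].
  rewrite /root /h !hornerE subr_eq0; apply/eqP.
  rewrite -[LHS]/(evz (z ^+ j) g) -fg -(fix_f _ jp).
  by apply: (evz_eq_prim zP) => //; exact: prim_rootX.
have sh : (size h < p)%N.
  rewrite (leq_ltn_trans (size_polyD _ _)) // gtn_max size_polyN.
  rewrite (leq_ltn_trans (size_polyC_leq1 _)) // andbT.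
  by rewrite size_map_inj_poly //; exact: intr_inj.
apply/eqP; apply: contraTT sh => hN0; rewrite -leqNgt.
by have := max_poly_roots hN0 rrs urs; rewrite size_map size_iota prednK.
Qed.

(** Represents the complex conjugate, as [z^* = z ^+ p.-1]. *)
Definition conjp f := f \Po 'X^(p.-1).

Lemma evz_conjp z f : p.-primitive_root z -> evz z (conjp f) = (evz z f)^*.
Proof.
move=> zP; rewrite evz_comp -prim_root_conj // /evz /= /horner_eval.
rewrite -horner_map -map_poly_comp; congr _.[_].
by apply: eq_map_poly => k /=; rewrite rmorph_int.
Qed.

Lemma conjp1 f : (conjp f).[1] = f.[1].
Proof. by rewrite horner_comp hornerXn expr1n. Qed.

(** Modulo [1 - z], f(z) is congruent to f(1), and [p], the value of [cyclop] at 1, to the value of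
    [cyclop] at [z], which is 0. *)
Lemma evz_horner1_dvd z f : p.-primitive_root z -> (p %| f.[1])%Z ->
  exists g, evz z f = (1 - z) * evz z g.
Proof.
have factor (h : {poly int}) : exists g, h - h.[1]%:P = (1 - 'X) * g.
  have /factor_theorem[g gE] : root (h - h.[1]%:P) 1.
    by rewrite /root !hornerE subrr.
  by exists (- g); rewrite gE mulrN -mulNr opprB mulrC.
move=> zP /dvdzP[k kE]; have [g gE] := factor f; have [h hE] := factor cyclop.
exists (g - k%:P * h).
have -> : (1 - z) = evz z (1 - 'X) by rewrite rmorphB /= rmorph1 evzX.
rewrite -rmorphM /= mulrBr -gE mulrCA -hE cyclop1 kE.
rewrite !(rmorphB, rmorphM) /= evz_cyclop // !evzC.
by rewrite natz sub0r mulrN opprK subrK.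
Qed.

Lemma one_sub_prim_neq0 z : p.-primitive_root z -> 1 - z != 0.
Proof. by move=> zP; rewrite subr_eq0 eq_sym prim_root_neq1. Qed.

Lemma evz_oneBX z m e : evz z ((1 - 'X) ^+ m * e) = (1 - z) ^+ m * evz z e.
Proof. by rewrite rmorphM rmorphXn rmorphB /= rmorph1 evzX. Qed.

(* 1 - z is prime, f(z) |-> f(1) mod p being the residue map, and f(z)^* has the
   same residue as f(z). *)
Lemma normC_descent z k f e : p.-primitive_root z ->
  evz z f * (evz z f)^* = (1 - z) ^+ k.*2 * evz z e ->
  exists g, evz z f = (1 - z) ^+ k * evz z g.
Proof.
move=> zP; elim: k f e => [|k IHk] f e fE; first by exists f; rewrite mul1r.
have : (p %| (f * conjp f - (1 - 'X) ^+ k.+1.*2 * e).[1])%Z.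
  apply: (evz_eq0_horner1 zP); rewrite rmorphB /= evz_oneBX.
  by rewrite rmorphM /= evz_conjp // fE subrr.
rewrite doubleS exprS -mulrA hornerD hornerN 2!hornerM conjp1.
rewrite [(1 - 'X).[1]]hornerD hornerN hornerX hornerC subrr mul0r subr0.
rewrite -expr2 => pf2.
have pf : (p %| f.[1])%Z.
  by move: pf2; rewrite !dvdzE abszX Euclid_dvdX // andbT.
have [g gE] := evz_horner1_dvd zP pf.
have zz : z * z^* = 1.
  by rewrite (prim_root_conj zP) -exprS prednK // prim_expr_order.
(* As [1 - z^*] is [1 - z] times the unit [- z^*], cancelling one factor in f(z) and one in its
   conjugate leaves a factor [- z]. *)
have [] := IHk g (- 'X * e); last first.
  by move=> h hE; exists h; rewrite gE hE mulrA exprS.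
have l0 := one_sub_prim_neq0 zP.
apply: (mulfI (expf_neq0 2 l0)).
rewrite rmorphM rmorphN /= evzX; transitivity (- z * (evz z f * (evz z f)^*)).
  rewrite gE rmorphM rmorphB /= rmorph1.
  set x := evz z g; set y := x^*; set w := z^*.
  rewrite [RHS](_ : _ = (z * w - z) * (1 - z) * (x * y)); last by ring.
  by rewrite zz expr2.
by rewrite fE doubleS !exprS; ring.
Qed.

Lemma prod_one_sub_prim z : p.-primitive_root z ->
  \prod_(x <- prim_roots z) (1 - x) = p%:R.
Proof.
move=> zP; have := factor_Xn_sub_1 zP.
rewrite big_ltn // expr0 polyC1.
have -> : 'X^p - 1 = ('X - 1) * map_poly intr cyclop :> {poly C}.
  have := congr1 (map_poly (intr : int -> C)) mulX1_cyclop.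
  by rewrite rmorphM !rmorphB /= map_polyX map_polyXn rmorph1.
have X10 : 'X - 1 != 0 :> {poly C} by rewrite -polyC1 polyXsubC_eq0.
move/(mulfI X10) => e; have {e} := congr1 (fun f : {poly C} => f.[1]) e => /=.
rewrite horner_prod -[1 in RHS](rmorph1 (intr : {rmorphism int -> C})).
rewrite horner_map cyclop1 /= rmorph_nat => <-.
rewrite /prim_roots big_map /index_iota subn1.
by apply: eq_bigr => i _; rewrite !hornerE.
Qed.

Lemma one_sub_prim_assoc z x : p.-primitive_root z -> p.-primitive_root x ->
  exists g, 1 - x = (1 - z) * evz z g.
Proof.
move=> zP xP; have [j ->] := prim_rootP zP (prim_expr_order xP).
exists (\sum_(i < j) 'X^i); rewrite rmorph_sum -opprB subrX1 -mulNr opprB.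
by congr (_ * _); apply: eq_bigr => i _; rewrite rmorphXn /= evzX.
Qed.

(** [p] is the product of the [1 - x], any two of which divide each other: total ramification. *)
Lemma one_sub_prim_exp z : p.-primitive_root z ->
  (exists g, p%:R = (1 - z) ^+ p.-1 * evz z g) /\
  (exists g, (1 - z) ^+ p.-1 = p%:R * evz z g).
Proof.
move=> zP; rewrite -(prod_one_sub_prim zP).
have : all p.-primitive_root (prim_roots z).
  by apply/allP=> x; rewrite mem_prim_roots.
have : size (prim_roots z) = p.-1 by rewrite size_map size_iota.
elim: (prim_roots z) p.-1 => [_ <- _|x s IHs _ <- /= /andP[xP sP]].
  by rewrite big_nil; split; exists 1; rewrite rmorph1 mulr1.
have [[g1 g1E] [h1 h1E]] := IHs _ erefl sP; rewrite big_cons exprS.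
have [g gE] := one_sub_prim_assoc zP xP.
have [h hE] := one_sub_prim_assoc xP zP.
have [j xE] := prim_rootP zP (prim_expr_order xP).
split; first by exists (g * g1); rewrite rmorphM /= g1E gE; ring.
exists ((h \Po 'X^j) * h1).
by rewrite rmorphM /= evz_comp -xE h1E hE; ring.
Qed.

(** Up to a unit [p] is [(1 - z) ^+ p.-1], so the descent extracts half of the prime factors, and
    these recombine into [p%:R ^+ m]. *)
Lemma evz_div z m f : p.-primitive_root z ->
  evz z f * (evz z f)^* = p%:R ^+ m.*2 ->
  exists g, evz z f = p%:R ^+ m * evz z g.
Proof.
move=> zP fE; have [[u uE] [v vE]] := one_sub_prim_exp zP.
have [|g ->] := @normC_descent z (p.-1 * m) f (u ^+ m.*2) zP.
  by rewrite fE uE exprMn -exprM -doubleMr rmorphXn.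
by exists (v ^+ m * g); rewrite rmorphM rmorphXn /= exprM vE exprMn mulrA.
Qed.

(* The product of the conjugates is an integer of absolute value < 1. *)
Lemma evz_norm_lt1 z f : p.-primitive_root z ->
  (forall x : C, p.-primitive_root x -> `|evz x f| < 1) -> evz z f = 0.
Proof.
move=> zP flt; pose N := \prod_(j <- iota 1 p.-1) (f \Po 'X^j).
have NE x : evz x N = \prod_(y <- prim_roots x) evz y f.
  by rewrite rmorph_prod big_map; apply: eq_bigr => j _; rewrite /= evz_comp.
have [j jp|k kE] := @evz_int_fixed z N zP.
  by rewrite !NE; apply/perm_big/perm_prim_roots => //; exact: prim_rootX.
have Nlt : `|evz z N| < 1.
  rewrite NE normr_prod big_seq.
  have := @ltr_prod C _ (prim_roots z) (mem (prim_roots z))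
            (fun x => `|evz x f|) (fun=> 1).
  rewrite [X in _ -> _ -> _ < X]big1_eq; apply.
    apply/hasP; exists z => /=; by rewrite mem_prim_roots.
  by move=> x /=; rewrite mem_prim_roots // normr_ge0 /= => /flt.
have : evz z N = 0.
  move: Nlt; rewrite kE -intr_norm -[1]/(1%:~R) ltr_int => k1.
  by rewrite (_ : k = 0) //; apply/eqP; rewrite -normr_le0 -ltzD1 add0r.
rewrite NE => /eqP; rewrite prodf_seq_eq0 => /hasP[x].
by rewrite mem_prim_roots //= => xP /eqP fx; exact: (evz_eq0_prim xP zP).
Qed.

(** Every conjugate of [1 + d e] still has modulus 1, so [d] times any conjugate of [e] has modulus
    at most 2; since [d > 2], all conjugates of [e] lie inside the unit disc. *)
Lemma unit_circle_eq1 z d e : p.-primitive_root z -> (2 < d)%N ->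
  `|1 + d%:R * evz z e| = 1 -> 1 + d%:R * evz z e = 1.
Proof.
move=> zP d2 v1; pose v := 1 + d%:R * e.
have vE (x : C) : evz x v = 1 + d%:R * evz x e.
  by rewrite /v rmorphD rmorphM /= rmorph1 rmorph_nat.
suff -> : evz z e = 0 by rewrite mulr0 addr0.
apply: evz_norm_lt1 => // x xP.
have vx : `|evz x v| = 1.
  have : evz x (v * conjp v) = evz x 1.
    apply: (evz_eq_prim zP) => //; rewrite rmorph1 rmorphM /= evz_conjp //.
    by rewrite -normCK vE v1 expr1n.
  rewrite rmorph1 rmorphM /= evz_conjp // -normCK => /eqP.
  by rewrite sqrp_eq1 // => /eqP.
have d0 : 0 < d%:R :> C by rewrite ltr0n (ltn_trans _ d2).
rewrite -(ltr_pM2l d0) mulr1 (@le_lt_trans _ _ 2%:R) ?ltr_nat //.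
rewrite -[d%:R]ger0_norm ?ler0n // -normrM.
have -> : d%:R * evz x e = evz x v - 1 by rewrite vE addrC addKr.
by rewrite (le_trans (ler_normB _ _)) // vx normr1 -natr1.
Qed.

(* |w|^2 is a power of p, so w equals each of its Galois conjugates y up to a
   unit v = y w^* / p^m of Z[z] with all conjugates on the unit circle; the
   congruence w = 1 (mod d) passes to v and forces v = 1. *)
Lemma evz_int_of_cong z m d h (w := 1 + d%:R * evz z h) :
  p.-primitive_root z -> (2 < d)%N -> w * w^* = p%:R ^+ m ->
  exists2 k : int, w = k%:~R & (d %| k - 1)%Z.
Proof.
move=> zP d2 ww; pose g := 1 + d%:R * h.
have gE (x : C) : evz x g = 1 + d%:R * evz x h.
  by rewrite /g rmorphD rmorphM /= rmorph1 rmorph_nat.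
have gg (x : C) : p.-primitive_root x -> evz x g * (evz x g)^* = p%:R ^+ m.
  move=> xP; rewrite -evz_conjp // -rmorphM /=.
  have -> : p%:R ^+ m = evz x (p%:R ^+ m) by rewrite rmorphXn /= rmorph_nat.
  apply: (evz_eq_prim zP) => //.
  by rewrite rmorphM rmorphXn /= rmorph_nat evz_conjp // gE.
have p0 : p%:R ^+ m != 0 :> C by rewrite expf_neq0 // pnatr_eq0 -lt0n.
have [j jp|k kE] := @evz_int_fixed z g zP; last first.
  exists k; first by rewrite -kE gE.
  apply: (@evz_int_dvd z _ _ h zP).
  by rewrite rmorphB /= -kE gE addrC addKr.
have yP := prim_rootX zP jp; set y := z ^+ j in yP *.
pose c := (g \Po 'X^j) * conjp g.
have cE : evz z c = evz y g * (evz z g)^*.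
  by rewrite /c rmorphM /= evz_comp evz_conjp.
have cc : evz z c * (evz z c)^* = p%:R ^+ m.*2.
  rewrite cE rmorphM /= conjCK mulrACA gg // [_^* * _]mulrC gg //.
  by rewrite -exprD addnn.
have [v vE] := evz_div zP cc.
have gcomp q : g \Po q = 1 + d%:R * (h \Po q).
  by rewrite /g rmorphD rmorphM /= rmorph1 rmorph_nat.
(* [e a b] is the cofactor of [d] in a product of two elements congruent to 1 modulo [d]. *)
pose e (a b : {poly int}) := a + b + d%:R * a * b.
have mulE a b :
    evz z ((1 + d%:R * a) * (1 + d%:R * b)) = 1 + d%:R * evz z (e a b).
  have -> : (1 + d%:R * a) * (1 + d%:R * b) = 1 + d%:R * e a b :> {poly int}.
    by rewrite /e; ring.
  by rewrite rmorphD rmorphM /= rmorph1 rmorph_nat.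
pose e1 := e (h \Po 'X^j) (conjp h); pose e2 := e h (conjp h).
have pmE : p%:R ^+ m = 1 + d%:R * evz z e2.
  by rewrite -mulE /conjp -gcomp rmorphM /= -/g -/(conjp _) evz_conjp // gg.
(* Both [c = p ^+ m * v] and [p ^+ m = w * w^*] are 1 modulo [d], hence so is [v]. *)
have v1 : evz z v = 1 + d%:R * evz z (e1 - e2 * v).
  have : evz z c = 1 + d%:R * evz z e1 by rewrite -mulE -!gcomp.
  rewrite vE pmE rmorphB rmorphM /= => vE'.
  by rewrite mulrBr addrA -vE'; ring.
have vn : `|evz z v| = 1.
  apply/eqP; rewrite -sqrp_eq1 // normCK.
  move: cc; rewrite vE rmorphM rmorphXn /= rmorph_nat mulrACA -exprD addnn.
  have p2m0 : p%:R ^+ m.*2 != 0 :> C by rewrite expf_neq0 // pnatr_eq0 -lt0n.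
  by move=> pvv; apply/eqP/(mulfI p2m0); rewrite pvv mulr1.
have v_eq1 : evz z v = 1 by rewrite v1; apply: unit_circle_eq1; rewrite // -v1.
have gz0 : (evz z g)^* != 0.
  by apply: contraNneq p0 => g0; rewrite -(gg z zP) g0 mulr0.
by apply: (mulIf gz0); rewrite gg // -cE vE v_eq1 mulr1.
Qed.

End PrimeRoot.

(** * Integers congruent to 1 with prescribed power sums *)

(** Modulo [p ^ t + 1] one has [p ^ t = -1], so lowering [m] by [t] exchanges the two signs; for
    [m < t] size leaves only [p ^ m - 1 = 0]. *)
Lemma dvdn_exp_pm1 p t m : (1 < p)%N -> (0 < t)%N ->
  (p ^ t + 1 %| p ^ m + 1)%N || (p ^ t + 1 %| p ^ m - 1)%N -> (t %| m)%N.
Proof.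
move=> p1 t0; have pt := ltn_expl t p1.
elim/ltn_ind: m => m IHm H; have [tm|mt] := leqP t m.
  have mE : m = ((m - t) + t)%N by rewrite subnK.
  rewrite mE dvdn_addl //; apply: IHm; first lia.
  have pm : (0 < p ^ (m - t))%N by rewrite expn_gt0 ltnW.
  move: H; rewrite mE expnD addnK.
  set a := (p ^ (m - t))%N in pm *; set b := (p ^ t)%N.
  have E1 : (a * b + 1 + (a - 1) = a * (b + 1))%N by nia.
  have E2 : (a * b - 1 + (a + 1) = a * (b + 1))%N by nia.
  have dm : (b + 1 %| a * (b + 1))%N by rewrite dvdn_mull.
  case/orP => H; apply/orP; [right|left].
    by rewrite -(dvdn_addr _ H) E1.
  by rewrite -(dvdn_addr _ H) E2.
have lt : (p ^ m + 1 < p ^ t + 1)%N by rewrite ltn_add2r ltn_exp2l.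
case/orP: H => /dvdn_leq; first by lia.
case: (posnP m) => [->//|m0].
have pm : (1 < p ^ m)%N by rewrite -(expn0 p) ltn_exp2l.
by rewrite subn_gt0 pm; lia.
Qed.

Section IntegerSpectrum.

Variables (T : finType) (A : {set T}) (p n d : nat) (k : T -> int).
Hypotheses (p_pr : prime p) (n_gt0 : (0 < n)%N) (d_gt2 : (2 < d)%N).
Hypotheses (cardA : #|A| = (p ^ n - 1)%N) (d_dvd : (d %| p ^ n - 1)%N).
Hypotheses (k_mod : forall b, b \in A -> (d %| k b - 1)%Z).
Hypotheses (k_sqr : forall b, b \in A -> exists s, k b ^+ 2 = (p ^ (n + s))%:Z).
Hypotheses (sum_k : \sum_(b in A) k b = 0).
Hypotheses (sum_k2 :
  \sum_(b in A) k b ^+ 2 = (p ^ n * ((d - 1) * (p ^ n - 1)))%:Z).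

Let pn_gt1 : (1 < p ^ n)%N.
Proof. by rewrite -(exp1n n) ltn_exp2r // prime_gt1. Qed.

Let sqrt_neq0 (x : int) : x ^+ 2 = (p ^ n)%:Z -> x != 0.
Proof. by move=> x2; rewrite -sqrf_eq0 x2 eqz_nat; lia. Qed.

(* Otherwise each k b ^+ 2 would be at least p ^ n * (d + 1), since p ^ s = 1
   modulo d, whereas their mean is p ^ n * (d - 1). *)
Lemma exists_k_sqr_min : exists2 b, b \in A & k b ^+ 2 = (p ^ n)%:Z.
Proof.
suff /exists_inP[b bA /eqP kb] : [exists b in A, k b ^+ 2 == (p ^ n)%:Z].
  by exists b.
apply: contraT; rewrite negb_exists_in => /forall_inP small.
have ge b : b \in A -> (p ^ n * (d + 1))%:Z <= k b ^+ 2.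
  move=> bA; have [s sE] := k_sqr bA; rewrite sE lez_nat expnD leq_mul2l.
  have s1 : (p ^ s != 1)%N.
    by apply: contra (small b bA) => /eqP s1; rewrite sE expnD s1 muln1.
  have : (d %| p ^ s - 1)%N.
    have : (d %| k b ^+ 2 - 1)%Z by rewrite subr_sqr_1 dvdz_mulr // k_mod.
    have ps0 : (0 < p ^ s)%N by rewrite expn_gt0 prime_gt0.
    rewrite sE expnD.
    have -> : (p ^ n * p ^ s)%:Z - 1 =
        (p ^ n - 1)%N%:Z * (p ^ s)%:Z + (p ^ s - 1)%N%:Z.
      by rewrite -!subzn // ?(ltnW pn_gt1) // PoszM; ring.
    by rewrite -PoszM -PoszD dvdzE /= dvdn_addr // dvdn_mulr.
  have : (0 < p ^ s)%N by rewrite expn_gt0 prime_gt0.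
  move: s1; case: (p ^ s)%N => [|[|q]] // _ _; rewrite subSS subn0 => /dvdn_leq.
  by move=> /(_ isT) dq; rewrite addn1 ltnS dq orbT.
have : \sum_(b in A) (p ^ n * (d + 1))%:Z <= \sum_(b in A) k b ^+ 2.
  by apply: ler_sum => b; exact: ge.
rewrite sum_k2 sumr_const cardA -natz -mulrnA natz lez_nat -mulnA.
rewrite leq_pmul2l ?expn_gt0 ?prime_gt0 // leq_pmul2r ?subn_gt0 //; lia.
Qed.

Lemma k_two_values : exists2 al : int,
  (al ^+ 2 = (p ^ n)%:Z /\ (d %| al - 1)%Z) &
  forall b, b \in A -> k b = al \/ k b = al * (1 - d%:Z).
Proof.
have [b0 b0A al2] := exists_k_sqr_min; exists (k b0).
  by split; last exact: k_mod.
set al := k b0 in al2 *.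
have al_neq0 := sqrt_neq0 al2.
have prod_ge0 b : b \in A -> 0 <= (k b - al) * (k b - al * (1 - d%:Z)).
  move=> bA; have [s sE] := k_sqr bA.
  have /dvdzP[r rE] : (al %| k b)%Z.
    by rewrite dvdzE -(@dvdn_pexp2r _ _ 2) // -!abszX sE al2 expnD dvdn_mulr.
  (* [al] is 1 modulo [d], hence invertible there, so dividing [k b] by [al] keeps the residue 1. *)
  have /dvdzP[q qE] : (d %| r - 1)%Z.
    have : (d %| (r - 1) * al)%Z.
      have -> : (r - 1) * al = (k b - 1) - (al - 1) by rewrite rE; ring.
      by apply: rpredB; apply: k_mod.
    rewrite Gauss_dvdzl //; have /dvdzP[u uE] := k_mod b0A.
    apply/coprimezP; exists (- u, 1) => /=; rewrite mulNr -uE -/al; ring.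
  have -> : (k b - al) * (k b - al * (1 - d%:Z))
      = (al * d%:Z) ^+ 2 * (q * (q + 1)).
    have -> : k b = (1 + q * d%:Z) * al by rewrite rE -qE; ring.
    ring.
  (* For an integer [q], the product of [q] and [q + 1] is never negative. *)
  rewrite mulr_ge0 ?sqr_ge0 //.
  have [q0|q0] := lerP 0 q; first by rewrite mulr_ge0 //; lia.
  by rewrite mulr_le0 //; lia.
(* The linear term drops out by [sum_k], and [sum_k2] cancels the constant term. *)
have sum0 : \sum_(b in A) (k b - al) * (k b - al * (1 - d%:Z)) = 0.
  have E b : (k b - al) * (k b - al * (1 - d%:Z)) =
     k b ^+ 2 + k b * (al * (d%:Z - 2)) + al ^+ 2 * (1 - d%:Z) by ring.
  rewrite (eq_bigr _ (fun b _ => E b)) !big_split /= sum_k2 -mulr_suml sum_k.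
  rewrite mul0r addr0 sumr_const cardA al2 -mulr_natr natz.
  rewrite !PoszM -(@subzn d) ?(ltn_trans _ d_gt2) //; ring.
move=> b bA; have /eqP := psumr_eq0P prod_ge0 sum0 bA.
by rewrite mulf_eq0 !subr_eq0 => /orP[]/eqP ->; [left|right].
Qed.

(** Since the [k b] sum to 0, the class [D] of the second value has [(p ^ n - 1) / d] elements. It
    is not empty, so [d - 1] divides a power of [p]; and [t] divides [n./2] because [al], which is
    [p ^ n./2] up to sign, is 1 modulo [p ^ t + 1]. *)
Lemma integer_spectrum : ~~ odd n /\ exists t : nat,
  [/\ (1 <= t)%N /\ (t %| n./2)%N, d = (p ^ t + 1)%N,
      forall b, b \in A ->
        k b ^+ 2 = (p ^ n)%:Z \/ k b ^+ 2 = (p ^ (n + t.*2))%:Z,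
      #|[set b in A | k b ^+ 2 == (p ^ n)%:Z]|
          = (p ^ n - 1 - (p ^ n - 1) %/ (p ^ t + 1))%N &
      #|[set b in A | k b ^+ 2 == (p ^ (n + t.*2))%:Z]|
          = ((p ^ n - 1) %/ (p ^ t + 1))%N].
Proof.
have [al [al2 al1] kE] := k_two_values.
have p_gt1 := prime_gt1 p_pr.
have al_neq0 := sqrt_neq0 al2.
have alN : (`|al|%N ^ 2 = p ^ n)%N by rewrite -abszX al2.
have [m alm] : exists m, `|al|%N = (p ^ m)%N.
  have : (`|al|%N %| p ^ n)%N by rewrite -alN dvdn_mulr.
  by case/(dvdn_pfactor _ _ p_pr) => m _ ->; exists m.
have nE : n = m.*2.
  by apply/eqP; rewrite -(eqn_exp2l _ _ p_gt1) -alN alm -expnM muln2.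
split; first by rewrite nE odd_double.
pose B := [set b in A | k b == al].
pose D := [set b in A | k b == al * (1 - d%:Z)].
have al_neq : (al == al * (1 - d%:Z)) = false.
  by rewrite -{1}[al]mulr1 (inj_eq (mulfI al_neq0)); apply/eqP; lia.
have BE : B = A :&: B by apply/setP=> b; rewrite !inE andbA andbb.
have DE : D = A :\: B.
  apply/setP=> b; rewrite !inE; case bA : (b \in A); rewrite ?andbF ?andbT //=.
  by have [->|->] := kE b bA; rewrite ?eqxx ?al_neq // eq_sym al_neq.
have cardBD : (#|B| + #|D| = p ^ n - 1)%N.
  by rewrite -cardA -(cardsID B A) -BE -DE.
have cardB : #|B| = (#|D| * (d - 1))%N.
  have : \sum_(b in A) k b = al * (#|B|%:Z - #|D|%:Z * (d%:Z - 1)).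
    rewrite (big_setID B) /= -BE -DE (eq_bigr (fun=> al)); last first.
      by move=> b; rewrite inE => /andP[_ /eqP].
    rewrite [X in _ + X](eq_bigr (fun=> al * (1 - d%:Z))); last first.
      by move=> b; rewrite inE => /andP[_ /eqP].
    rewrite !sumr_const.
    rewrite -[al *+ _]mulr_natr -[(_ * _) *+ _]mulr_natr !natz; ring.
  rewrite sum_k => /esym/eqP.
  rewrite mulf_eq0 (negPf al_neq0) /= subr_eq0 => /eqP.
  by rewrite subzn ?(ltn_trans _ d_gt2) // -PoszM => -[].
have cardDd : (#|D| * d = p ^ n - 1)%N.
  rewrite -cardBD cardB; case: (d) d_gt2 => // d' _.
  by rewrite subSS subn0 mulnS addnC.
have [b bD] : exists b, b \in D.
  apply/set0Pn; rewrite -cards_eq0; apply: contraTneq pn_gt1 => D0.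
  by move: cardDd; rewrite D0 mul0n; lia.
move: bD; rewrite inE => /andP[bA /eqP kb].
have [s sE] := k_sqr bA.
have [t dE] : exists t, (d - 1 = p ^ t)%N.
  have : (d - 1 %| p ^ (n + s))%N.
    have -> : (p ^ (n + s) = `|k b| ^ 2)%N by rewrite -abszX sE.
    rewrite kb abszM expnMn dvdn_mull //.
    by rewrite (_ : `|1 - d%:Z|%N = d - 1)%N ?dvdn_mulr //; lia.
  by case/(dvdn_pfactor _ _ p_pr) => t _ ->; exists t.
have dE' : d = (p ^ t + 1)%N by lia.
have t_gt0 : (0 < t)%N.
  by rewrite lt0n; apply: contraTneq d_gt2 => t0; rewrite dE' t0.
have kB c : k c = al -> k c ^+ 2 = (p ^ n)%:Z by move=> ->.
have kD c : k c = al * (1 - d%:Z) -> k c ^+ 2 = (p ^ (n + t.*2))%:Z.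
  move=> ->; rewrite exprMn al2 expnD -muln2 expnM -dE PoszM; congr (_ * _).
  rewrite -mulnn PoszM -!subzn ?(ltn_trans _ d_gt2) //; ring.
have n_neq : (p ^ n)%:Z != (p ^ (n + t.*2))%:Z :> int.
  rewrite eqz_nat eqn_exp2l // -{1}[n]addn0 eqn_add2l eq_sym.
  by rewrite double_eq0 -lt0n.
have cardDq : #|D| = ((p ^ n - 1) %/ (p ^ t + 1))%N.
  by rewrite -dE' -cardDd mulnK // (ltn_trans _ d_gt2).
exists t; split => //.
- split => //; rewrite nE doubleK; apply: (dvdn_exp_pm1 p_gt1) => //.
  (* The sign of [al] decides which of the two divisibilities holds. *)
  rewrite -alm -dE'; move: al1; rewrite dvdzE; have [a0|a0] := lerP 0 al.
    have -> : `|al - 1|%N = (`|al| - 1)%N by clear -a0 al_neq0; lia.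
    by move=> ->; rewrite orbT.
  have -> : `|al - 1|%N = (`|al| + 1)%N by clear -a0; lia.
  by move=> ->.
- by move=> c /kE[/kB|/kD]; [left|right].
- rewrite -cardDq -cardBD addnK; apply: eq_card => c; rewrite !inE.
  case cA : (c \in A) => //=; have [ck|ck] := kE c cA.
    by rewrite (kB c ck) ck !eqxx.
  rewrite (kD c ck) eq_sym (negPf n_neq); apply/esym/eqP => ca.
  by move: n_neq; rewrite -(kB c ca) (kD c ck) eqxx.
- rewrite -cardDq; apply: eq_card => c; rewrite !inE.
  case cA : (c \in A) => //=; have [ck|ck] := kE c cA.
    rewrite (kB c ck) (negPf n_neq); apply/esym/eqP => ca.
    by move: n_neq; rewrite -(kB c ck) (kD c ca) eqxx.
  by rewrite (kD c ck) ck !eqxx.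
Qed.

End IntegerSpectrum.

(** * Fourier analysis on F_p^n *)

Section Characters.

Variables (C : numClosedFieldType) (p n : nat) (z : C).
Hypotheses (p_pr : prime p) (zP : p.-primitive_root z).
Local Notation V := 'rV['F_p]_n.

Definition chi (a : 'F_p) : C := z ^+ nat_of_ord a.

Lemma chi0 : chi 0 = 1. Proof. by []. Qed.

Lemma chiD a b : chi (a + b) = chi a * chi b.
Proof.
have -> : chi (a + b) = z ^+ ((a + b) %% p)%N.
  by rewrite /chi -[X in (_ %% X)%N](Fp_cast p_pr).
by rewrite (prim_expr_mod zP) exprD.
Qed.

Lemma chi_conj a : (chi a)^* = chi (- a).
Proof.
have nz : chi a != 0 by rewrite expf_neq0 // (prim_root_eq0 zP) -lt0n prime_gt0.
apply: (mulfI nz); rewrite -chiD subrr chi0 -normCK normrX.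
by rewrite (norm_prim_root p_pr zP) !expr1n.
Qed.

Lemma chi_eq1 a : (chi a == 1) = (a == 0).
Proof.
rewrite /chi -(prim_order_dvd zP) -val_eqE /=.
have ap : (a < p)%N by rewrite -{2}(Fp_cast p_pr).
by rewrite /dvdn modn_small.
Qed.

Lemma dotDl (x y w : V) : dot (x + y) w = dot x w + dot y w.
Proof. by rewrite -big_split; apply: eq_bigr => i _; rewrite mxE mulrDl. Qed.

Lemma dotC (x y : V) : dot x y = dot y x.
Proof. by apply: eq_bigr => i _; rewrite mulrC. Qed.

Lemma dotNr (x y : V) : dot x (- y) = - dot x y.
Proof. by rewrite -sumrN; apply: eq_bigr => i _; rewrite mxE mulrN. Qed.

Lemma dotBr (x y w : V) : dot x (y - w) = dot x y - dot x w.
Proof. by rewrite dotC dotDl ![dot _ x]dotC dotNr. Qed.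

Lemma dot0l (x : V) : dot 0 x = 0.
Proof. by apply: big1 => i _; rewrite mxE mul0r. Qed.

Lemma card_rVFp : #|{: V}| = (p ^ n)%N.
Proof. by rewrite card_mx mul1n card_Fp. Qed.

(** Orthogonality: shifting by a unit vector at a nonzero coordinate of [v] multiplies the sum by a
    root of unity other than 1. *)
Lemma sum_chi_dot (v : V) :
  \sum_b chi (dot b v) = if v == 0 then (p ^ n)%:R else 0.
Proof.
case: ifPn => [/eqP->|v0].
  rewrite (eq_bigr (fun=> 1)) => [|b _]; last by rewrite dotC dot0l.
  by rewrite sumr_const card_rVFp.
have [i vi] : exists i, v ord0 i != 0.
  apply/existsP; apply: contraR v0; rewrite negb_exists => /forallP v0.
  by apply/eqP/rowP => i; rewrite mxE; apply/eqP; move: (v0 i); rewrite negbK.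
pose u : V := delta_mx ord0 i.
have uv : dot u v = v ord0 i.
  rewrite /dot (bigD1 i) //= big1 ?addr0 => [|j ji].
    by rewrite mxE !eqxx mul1r.
  by rewrite mxE (negPf ji) andbF mul0r.
have : (chi (dot u v) - 1) * \sum_b chi (dot b v) = 0.
  rewrite mulrBl mul1r mulr_sumr.
  rewrite [X in _ - X](reindex_inj (addrI u)) /=.
  apply/eqP; rewrite subr_eq0; apply/eqP.
  by apply: eq_bigr => b _; rewrite dotDl chiD.
by move/eqP; rewrite mulf_eq0 subr_eq0 chi_eq1 uv (negPf vi) => /eqP.
Qed.

(** Orthogonality leaves only the pairs with equal [G]. The weight [c] and the map [G] are free so
    that Parseval for one function and the count of collisions of [F] are both instances. *)
Lemma plancherel (c : V -> C) (G : V -> V)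
    (S := fun b => \sum_x c x * chi (dot b (G x))) :
  \sum_b S b * (S b)^* =
    (p ^ n)%:R * \sum_x \sum_(y | G y == G x) c x * (c y)^*.
Proof.
pose T x y := c x * (c y)^*.
have SE b : S b * (S b)^* = \sum_x \sum_y T x y * chi (dot b (G x - G y)).
  rewrite /S rmorph_sum mulr_suml; apply: eq_bigr => x _.
  rewrite mulr_sumr; apply: eq_bigr => y _.
  by rewrite rmorphM /= chi_conj dotBr chiD /T; ring.
rewrite (eq_bigr _ (fun b _ => SE b)) exchange_big mulr_sumr.
apply: eq_bigr => x _ /=.
rewrite exchange_big mulr_sumr [RHS]big_mkcond; apply: eq_bigr => y _ /=.
rewrite -mulr_sumr sum_chi_dot subr_eq0 eq_sym.
by case: ifP => _; rewrite ?mulr0 // mulrC.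
Qed.

Lemma parseval (f : V -> 'F_p)
    (W := fun a => \sum_x chi (f x - dot a x)) :
  \sum_a W a * (W a)^* = (p ^ n)%:R ^+ 2.
Proof.
have WE a : W a = \sum_x chi (f x) * chi (dot a (- x)).
  by apply: eq_bigr => x _; rewrite dotNr chiD.
rewrite (eq_bigr (fun a => (\sum_x chi (f x) * chi (dot a (- x))) *
   (\sum_x chi (f x) * chi (dot a (- x)))^*)) => [|a _]; last by rewrite WE.
rewrite plancherel expr2; congr (_ * _).
rewrite (eq_bigr (fun=> 1)) => [|x _].
  by rewrite sumr_const card_rVFp.
rewrite (eq_bigl (pred1 x)) => [|y]; last by rewrite (inj_eq oppr_inj).
by rewrite big_pred1_eq chi_conj -chiD subrr chi0.
Qed.

End Characters.

(** * Walsh spectrum of d-to-1 plateaued functions *)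

Section Dto1.

Variables (C : numClosedFieldType) (p n d : nat) (z : C).
Hypotheses (p_pr : prime p) (zP : p.-primitive_root z) (d_gt2 : (2 < d)%N).
Local Notation V := 'rV['F_p]_n.
Variables (F : V -> V) (y0 : V).
Hypothesis fiberE : forall x, #|fiber F (F x)| = if F x == y0 then 1%N else d.
Hypothesis fiber_y0 : #|fiber F y0| = 1%N.

Lemma sum_fiber (R : pzSemiRingType) (c : R) y :
  \sum_(x | F x == y) c = #|fiber F y|%:R * c.
Proof.
rewrite sumr_const mulr_natl; congr (_ *+ _).
by apply: eq_card => x; rewrite !inE.
Qed.

(** W_F(b,0) up to a root of unity; subtracting [y0] makes its single preimage contribute exactly
    1. *)
Definition shifted_sum (b : V) : C := \sum_x chi z (dot b (F x - y0)).

Lemma shifted_sumE b : exists h, shifted_sum b = 1 + d%:R * evz z h.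
Proof.
(* One power of [z] for each attained value other than [y0]; its fiber repeats it [d] times. *)
exists (\sum_(y | (y != y0) && (fiber F y != finset.set0)) 'X^(dot b (y - y0))).
rewrite /shifted_sum (partition_big F predT) //= (bigD1 y0) //=; congr (_ + _).
  rewrite (eq_bigr (fun=> 1)) => [|x /eqP ->]; last by rewrite subrr dotC dot0l.
  by rewrite sum_fiber fiber_y0 mulr1.
rewrite rmorph_sum mulr_sumr [LHS]big_mkcond [RHS]big_mkcond /=.
apply: eq_bigr => y _; case: eqVneq => //= y_y0.
have -> : \sum_(x | F x == y) chi z (dot b (F x - y0)) =
    #|fiber F y|%:R * chi z (dot b (y - y0)).
  by rewrite -sum_fiber; apply: eq_bigr => x /eqP ->.
case: ifPn => [|/negPn/eqP ->]; last by rewrite cards0 mul0r.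
case/set0Pn => x; rewrite inE => /eqP xy.
by rewrite -xy fiberE xy (negPf y_y0) rmorphXn /= evzX.
Qed.

Lemma shifted_sum0 : shifted_sum 0 = (p ^ n)%:R.
Proof.
rewrite /shifted_sum (eq_bigr (fun=> 1)) => [|x _]; last by rewrite dot0l.
by rewrite sumr_const card_rVFp.
Qed.

(** Over all [b], orthogonality keeps only the preimage of [y0] and gives [p ^ n], which is already
    the term at [b = 0]. *)
Lemma sum_shifted_sum : \sum_(b | b != 0) shifted_sum b = 0.
Proof.
apply: (addrI (shifted_sum 0)); transitivity (\sum_b shifted_sum b).
  by rewrite [RHS](bigD1 0).
rewrite addr0 exchange_big /=.
rewrite (eq_bigr (fun x => if F x == y0 then (p ^ n)%:R else 0)).
  by rewrite -big_mkcond sum_fiber fiber_y0 mul1r shifted_sum0.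
by move=> x _; rewrite sum_chi_dot // subr_eq0.
Qed.

(** Plancherel counts the pairs with equal images, [1 + d * (p ^ n - 1)] of them; the term at
    [b = 0] is then removed. *)
Lemma sum_shifted_sum2 :
  \sum_(b | b != 0) shifted_sum b * (shifted_sum b)^* =
    (p ^ n * ((d - 1) * (p ^ n - 1)))%:R.
Proof.
apply: (addrI (shifted_sum 0 * (shifted_sum 0)^*)).
transitivity (\sum_b shifted_sum b * (shifted_sum b)^*).
  by rewrite [RHS](bigD1 0).
rewrite (eq_bigr (fun b => (\sum_x 1 * chi z (dot b (F x - y0))) *
   (\sum_x 1 * chi z (dot b (F x - y0)))^*)); last first.
  by move=> b _; congr (_ * _^*); apply: eq_bigr => x _; rewrite mul1r.
rewrite (plancherel p_pr zP (fun=> 1) (fun x => F x - y0)).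
rewrite shifted_sum0 rmorph_nat -!natrM.
rewrite (eq_bigr (fun x => (if F x == y0 then 1%N else d)%:R)); last first.
  move=> x _; rewrite rmorph1 mulr1 -fiberE -[RHS]mulr1 -sum_fiber.
  by apply: eq_bigl => y; rewrite (inj_eq (addIr _)).
rewrite -natr_sum -natrM -natrD; congr (_%:R).
rewrite -mulnDr; congr (_ * _)%N.
have sum_y0 (c : nat) : (\sum_(x | F x == y0) c = c)%N.
  by rewrite (@sum_fiber nat) fiber_y0 mul1r.
have := card_rVFp n p_pr.
rewrite -sum1_card (bigID (fun x => F x == y0)) /= sum_y0 => E.
rewrite (bigID (fun x => F x == y0)) /=.
rewrite (eq_bigr (fun=> 1%N)) => [|x ->] //.
rewrite sum_y0 (eq_bigr (fun=> d * 1)%N); last first.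
  by move=> x /negPf ->; rewrite muln1.
by rewrite -big_distrr /=; move: E; set S := (\sum_(i | _) _)%N; nia.
Qed.

End Dto1.

(** * The root of unity in [R[i]] and squared Walsh moduli *)

Section Zeta.

Variables (R : realType) (p : nat).
Hypothesis p_pr : prime p.

Lemma zetaX k : zeta R p ^+ k =
  Complex (cos (2 * pi / p%:R * k%:R)) (sin (2 * pi / p%:R * k%:R)).
Proof.
elim: k => [|k IHk]; first by rewrite mulr0 cos0 sin0.
rewrite exprSr IHk /zeta -[k.+1%:R]natr1; set x := 2 * pi / p%:R.
by rewrite mulrDr mulr1 cosD sinD; simpc; congr (Complex _ _); ring.
Qed.

Lemma zeta_prim : p.-primitive_root (zeta R p).
Proof.
have p0 : p%:R != 0 :> R by rewrite pnatr_eq0 -lt0n prime_gt0.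
apply: prim_root_prime => //.
  by rewrite zetaX divfK // mulr_natl cos2pi sin2pi.
apply/eqP => -[c1 _].
have x0 : 0 < 2 * pi / p%:R :> R.
  by rewrite divr_gt0 ?mulr_gt0 ?pi_gt0 // ltr0n prime_gt0.
(* As [p] is at least 2, the angle lies between 0 and pi, where cos is injective. *)
have : 2 * pi / p%:R = 0 :> R.
  apply: cos_inj; rewrite ?in_itv /= ?lexx ?pi_ge0 ?cos0 // ltW //=.
  rewrite ler_pdivrMr ?ltr0n ?prime_gt0 // mulrC ler_wpM2l ?pi_ge0 //.
  by rewrite ler_nat prime_gt1.
by move=> x00; move: x0; rewrite x00 ltxx.
Qed.

Lemma mul_conj_modulus (u : R[i]) : u * u^* = real_complex R (modulus u ^+ 2).
Proof. by rewrite -normCK rmorphXn. Qed.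

Lemma modulus_ge0 (u : R[i]) : 0 <= modulus u.
Proof. by case: u => a b; exact: sqrtr_ge0. Qed.

(** Squaring turns half-integral exponents into natural ones, so the criteria below are stated for
    squared moduli. *)
Lemma powR_half_sqr (m : nat) : (p%:R `^ (m%:R / 2) : R) ^+ 2 = p%:R ^+ m.
Proof.
rewrite -powR_mulrn ?powR_ge0 // -powRrM divfK ?pnatr_eq0 //.
by rewrite powR_mulrn ?ler0n.
Qed.

Lemma sqr_modulus_eq (u : R[i]) (x : R) : 0 <= x ->
  (modulus u == x) = (modulus u ^+ 2 == x ^+ 2).
Proof. by move=> x0; rewrite eqrXn2 // modulus_ge0. Qed.

Variables (n : nat) (f : 'rV['F_p]_n -> 'F_p).

Lemma parseval_modulus :
  \sum_a modulus (walsh R f a) ^+ 2 = (p%:R ^+ n) ^+ 2.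
Proof.
apply: complexI; rewrite rmorph_sum !rmorphXn /= rmorph_nat -natrX.
rewrite -(parseval p_pr zeta_prim f).
by apply: eq_bigr => a _; rewrite mul_conj_modulus.
Qed.

Lemma t_plateauedP s : t_plateaued R s f <->
  forall a, modulus (walsh R f a) ^+ 2 = 0 \/
            modulus (walsh R f a) ^+ 2 = p%:R ^+ (n + s).
Proof.
split=> [/forallP H a|H].
  have /orP[/eqP->|/eqP->] := H a; first by left; rewrite expr0n.
  by right; rewrite powR_half_sqr.
apply/forallP=> a; rewrite -(sqrf_eq0 (modulus _)).
rewrite [X in _ || X]sqr_modulus_eq ?powR_ge0 // powR_half_sqr.
by have [->|->] := H a; rewrite eqxx ?orbT.
Qed.

Lemma bentP : bent R f <->
  forall a, modulus (walsh R f a) ^+ 2 = p%:R ^+ n.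
Proof.
split=> [/forallP H a|H]; first by rewrite (eqP (H a)) powR_half_sqr.
by apply/forallP=> a; rewrite sqr_modulus_eq ?powR_ge0 // powR_half_sqr H.
Qed.

(** No squared modulus exceeds [p ^ n], while by Parseval this is their mean, so none is smaller. *)
Lemma bent_of_plateaued0 : t_plateaued R 0 f -> bent R f.
Proof.
move/t_plateauedP; rewrite addn0 => H; apply/bentP => a.
have le b : modulus (walsh R f b) ^+ 2 <= p%:R ^+ n.
  by have [->|->] := H b; rewrite // exprn_ge0 // ler0n.
have : \sum_b (p%:R ^+ n - modulus (walsh R f b) ^+ 2) = 0.
  rewrite sumrB parseval_modulus sumr_const card_rVFp //.
  by rewrite -[X in X - _]mulr_natr natrX expr2 subrr.
move/psumr_eq0P => H0; apply/eqP; rewrite eq_sym -subr_eq0; apply/eqP.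
by apply: H0 => // b _; rewrite subr_ge0.
Qed.

End Zeta.

Lemma d_to_1_fibers (p n d : nat) (F : 'rV['F_p]_n -> 'rV['F_p]_n) :
  d_to_1 d F -> exists2 y0, #|fiber F y0| = 1%N &
    forall x, #|fiber F (F x)| = if F x == y0 then 1%N else d.
Proof.
case=> _ /eqP/cards1P[y0 /setP y0E] dF.
have E y : (#|fiber F y| == 1%N) = (y == y0) by have := y0E y; rewrite !inE.
exists y0 => [|x]; first by apply/eqP; rewrite E.
case: ifPn => [/eqP->|xy]; first by apply/eqP; rewrite E.
apply: dF; first by apply/set0Pn; exists x; rewrite inE.
by apply/eqP; rewrite E.
Qed.

(** * Integrality of the Walsh values at 0 *)

Section Main.

Variables (R : realType) (p n : nat) (F : 'rV['F_p]_n -> 'rV['F_p]_n).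
Variables (d : nat).
Hypotheses (p_pr : prime p) (d_gt2 : (2 < d)%N).
Hypotheses (plF : plateaued R F) (dF : d_to_1 d F).

Local Notation M b a := (modulus (walsh R (component F b) a)).

Lemma walsh0_spectrum : exists k : 'rV['F_p]_n -> int,
  [/\ forall b, b != 0 -> M b 0 ^+ 2 = (k b ^+ 2)%:~R,
      forall b, b != 0 -> (d %| k b - 1)%Z,
      \sum_(b | b != 0) k b = 0 &
      \sum_(b | b != 0) k b ^+ 2 = (p ^ n * ((d - 1) * (p ^ n - 1)))%:Z].
Proof.
have [y0 y0_1 fibE] := d_to_1_fibers dF.
have zP := zeta_prim R p_pr; set z := zeta R p in zP.
pose w := shifted_sum z F y0.
have MW b : real_complex R (M b 0 ^+ 2) = w b * (w b)^*.
  rewrite -mul_conj_modulus.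
  have -> : walsh R (component F b) 0 = chi z (dot b y0) * w b.
    rewrite /w /shifted_sum mulr_sumr; apply: eq_bigr => x _.
    by rewrite dot0l subr0 -chiD // dotBr addrC subrK.
  by rewrite rmorphM /= chi_conj // mulrACA -chiD // subrr chi0 mul1r.
(* The condition on [b] stays inside the existential so that choice gives a total function; nothing
   is claimed at [b = 0]. *)
have wk b : exists k : int, b != 0 -> w b = k%:~R /\ (d %| k - 1)%Z.
  have [h hE] := shifted_sumE z fibE y0_1 b.
  case: (eqVneq b 0) => [_|b0]; first by exists 0.
  have [s /t_plateauedP /(_ 0)[Ms|Ms]] := plF b0.
    (* Vanishing is impossible: it would make [d] divide -1. *)
    have w0 : w b = 0.
      by apply/eqP; rewrite -normr_eq0 -sqrf_eq0 normCK -MW Ms rmorph0.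
    have : (d %| - 1)%Z.
      apply: (evz_int_dvd p_pr (f := h) zP).
      by apply: (addrI 1); rewrite -hE -/(w b) w0 rmorphN1 subrr.
    by rewrite dvdzE /= dvdn1; case: (d) d_gt2 => [|[|]].
  have ww : w b * (w b)^* = p%:R ^+ (n + s).
    by rewrite -MW Ms rmorphXn /= rmorph_nat.
  rewrite /w hE in ww.
  have [k kE dk] := evz_int_of_cong p_pr zP d_gt2 ww.
  by exists k => _; rewrite /w hE.
have [k kP] := fin_all_exists wk; exists k; split.
- move=> b b0; apply: complexI; rewrite MW (kP b b0).1 rmorph_int.
  by rewrite -intrM -expr2 rmorph_int.
- by move=> b /kP[].
- apply: (@intr_inj R[i]); rewrite rmorph_sum /=.
  rewrite -[RHS](sum_shifted_sum p_pr zP y0_1); apply: eq_bigr => b b0.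
  by rewrite -(kP b b0).1.
apply: (@intr_inj R[i]); rewrite rmorph_sum /=.
rewrite -[RHS](sum_shifted_sum2 p_pr zP d_gt2 fibE y0_1).
apply: eq_bigr => b b0.
by rewrite -/(w b) (kP b b0).1 rmorph_int -intrM -expr2.
Qed.

(** The value at 0 is not zero, so it already reveals the amplitude valid at every [a]. *)
Lemma plateaued_dichotomy b (q : int) (m : nat) : b != 0 ->
  M b 0 ^+ 2 = q%:~R -> q = (p ^ m)%:Z ->
  forall a, M b a ^+ 2 = 0 \/ M b a ^+ 2 = p%:R ^+ m.
Proof.
move=> b0 Mq qm a; have [s /t_plateauedP H] := plF b0.
have [M0|M0] := H 0.
  move/eqP: Mq; rewrite M0 qm eq_sym intr_eq0 eqz_nat expn_eq0.
  by rewrite (gtn_eqF (prime_gt0 p_pr)).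
have [->|->] := H a; [by left|right].
by rewrite -M0 Mq qm -pmulrn natrX.
Qed.

End Main.

(** * Counting the components and computing the linearity *)

Theorem theorem5p2 (R : realType) (p n : nat) (hp : prime p) (hn : (0 < n)%N)
    (F : 'rV['F_p]_n -> 'rV['F_p]_n) (hF : plateaued R F)
    (d : nat) (hd : (2 < d)%N) (hFd : d_to_1 d F) :
  ~~ odd n /\
  exists t : nat,
    [/\ (1 <= t)%N /\ (t %| n./2)%N,
        d = (p ^ t + 1)%N,
        #|[set b : 'rV['F_p]_n | (b != 0) && bent R (component F b)]|
          = (p ^ n - 1 - (p ^ n - 1) %/ (p ^ t + 1))%N,
        #|[set b : 'rV['F_p]_n | (b != 0) &&
            plateaued_amplitude (p%:R ^+ (n./2 + t) : R) (component F b)]|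
          = ((p ^ n - 1) %/ (p ^ t + 1))%N
      & linearity R F = p%:R ^+ (n./2 + t)].
Proof.
have [k [Mk k_mod sum_k sum_k2]] := walsh0_spectrum hp hd hF hFd.
have p_gt0 := prime_gt0 hp; have p_gt1 := prime_gt1 hp.
pose A := [set~ 0 : 'rV['F_p]_n].
have inA b : (b \in A) = (b != 0) by rewrite !inE.
have powZ m : (p ^ m)%:Z%:~R = p%:R ^+ m :> R by rewrite -pmulrn natrX.
have k_sqr b : b \in A -> exists s, k b ^+ 2 = (p ^ (n + s))%:Z.
  rewrite inA => b0; have [s /t_plateauedP /(_ 0)[M0|M0]] := hF b b0; exists s.
    (* A zero value contradicts that [k b] is 1 modulo [d]. *)
    have k0 : k b = 0.
      move: (Mk b b0); rewrite M0 => /esym/eqP.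
      by rewrite intr_eq0 sqrf_eq0 => /eqP.
    by have := k_mod b b0; rewrite k0 dvdzE /= dvdn1; case: (d) hd => [|[|]].
  by apply: (@intr_inj R); rewrite -Mk // M0 powZ.
have cardA : #|A| = (p ^ n - 1)%N by rewrite cardsC1 card_rVFp // subn1.
have [||||odd_n [t [[t_gt0 t_n] dE kE cardB cardD]]] :=
  integer_spectrum hp hn hd cardA _ _ k_sqr.
- by case: hFd.
- by move=> b; rewrite inA; exact: k_mod.
- by rewrite -[RHS]sum_k; apply: eq_bigl => b; rewrite inA.
- by rewrite -[RHS]sum_k2; apply: eq_bigl => b; rewrite inA.
split=> //; exists t.
have nE : (n + t.*2 = (n./2 + t).*2)%N by rewrite doubleD even_halfK.
have dich b m := @plateaued_dichotomy R p n F hp hF b (k b ^+ 2) m.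
have Amp2 : (p%:R ^+ (n./2 + t) : R) ^+ 2 = p%:R ^+ (n + t.*2).
  by rewrite -exprM muln2 nE.
have Amp_ge0 : 0 <= p%:R ^+ (n./2 + t) :> R by rewrite exprn_ge0 // ler0n.
(* Guarantees a component of the larger amplitude, at which the linearity is attained. *)
have cardD0 : (0 < (p ^ n - 1) %/ (p ^ t + 1))%N.
  have [d_dvd _ _] := hFd; rewrite -dE divn_gt0 ?(ltn_trans _ hd) //.
  by apply: dvdn_leq => //; rewrite subn_gt0 -(expn0 p) ltn_exp2l.
split=> //.
- rewrite -cardB; apply: eq_card => b; rewrite !inE; case: eqVneq => //= b0.
  (* Bentness is read off at 0; conversely the dichotomy gives a 0-plateaued component, and Parseval
     excludes its zeros. *)
  apply/idP/eqP => [/bentP /(_ 0)|kb].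
    by rewrite Mk // => /esym Mp; apply: (@intr_inj R); rewrite -Mp powZ.
  apply: bent_of_plateaued0 => //; apply/t_plateauedP; rewrite addn0.
  exact: (dich b n b0 (Mk b b0) kb).
- rewrite -cardD; apply: eq_card => b; rewrite !inE; case: eqVneq => //= b0.
  have bA : b \in A by rewrite inA.
  apply/forallP/eqP => [/(_ 0)|kb a].
    rewrite -(sqrf_eq0 (modulus _)) [X in _ || X]sqr_modulus_eq // Mk //.
    rewrite Amp2 -powZ.
    (* The definition of amplitude allows the value 0 here, but [k b ^+ 2] is a power of [p]. *)
    rewrite intr_eq0 (inj_eq intr_inj) => /orP[/eqP kb0|/eqP//].
    have [] := kE b bA; rewrite kb0 // => /esym/eqP.
    by rewrite eqz_nat expn_eq0 (gtn_eqF p_gt0).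
  rewrite -(sqrf_eq0 (modulus _)) [X in _ || X]sqr_modulus_eq // Amp2.
  by have [->|->] := dich b _ b0 (Mk b b0) kb a; rewrite eqxx ?orbT.
(* The dichotomy bounds every modulus; equality occurs at [a = 0] for a component of the larger
   amplitude. *)
apply/eqP; rewrite eq_le; apply/andP; split.
  apply: bigmax_le => // b b0; apply: bigmax_le => // a _.
  rewrite -(ler_pXn2r (n := 2)) ?nnegrE ?modulus_ge0 // Amp2.
  have bA : b \in A by rewrite inA.
  have [kb|kb] := kE b bA; have [->|->] := dich b _ b0 (Mk b b0) kb a;
    by rewrite ?exprn_ge0 ?ler0n // ler_weXn2l ?ler1n ?leq_addr.
have /card_gt0P[b] : (0 < #|[set b in A | k b ^+ 2 == (p ^ (n + t.*2))%:Z]|)%N.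
  by rewrite cardD.
rewrite inE inA => /andP[b0 /eqP kb].
have -> : p%:R ^+ (n./2 + t) = modulus (walsh R (component F b) 0).
  by apply/eqP; rewrite eq_sym sqr_modulus_eq // Amp2 Mk // kb powZ.
rewrite /linearity (bigD1 b) //= le_max; apply/orP; left.
exact: le_bigmax.
Qed.
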